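(* A bipartite graph $G=(V,E)$ without isolated vertices is a unique key graph if and only if $E$ is a perfect matching of $G$.
   Context: A pure Horn clause $A\to v$ ($A\subseteq V$, $v\in V$) stands for $v\vee\bigvee_{a\in A}\bar a$; a Boolean function $h:\{0,1\}^V\to\{0,1\}$ is pure Horn if it is a conjunction of such clauses; $A\to v$ is an implicate of $h$ if every true point of $h$ satisfies it; $K\subseteq V$ is a key of $h$ if $K\to w$ is an implicate for all $w\in V\setminus K$; $\mathcal{K}(h)$ is the family of minimal keys. A Sperner hypergraph $\mathcal{B}\subseteq 2^V$ is a unique key hypergraph if there is exactly one pure Horn function $h$ on $V$ with $\mathcal{K}(h)=\mathcal{B}$. A graph $G=(V,E)$ is a unique key graph if $E$, viewed as a hypergraph of $2$-element subsets of $V$, is a unique key hypergraph. *)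

(* Defs.v *)
From mathcomp Require Import all_boot.

Set Implicit Arguments.
Unset Strict Implicit.
Unset Printing Implicit Defensive.

(* Points of {0,1}^V and Boolean functions are finite functions, so that
   Leibniz equality of Boolean functions is pointwise equality. *)
Definition point (V : finType) := {ffun V -> bool}.
Definition boolfun (V : finType) := {ffun point V -> bool}.

Section Horn.

Variable V : finType.
Implicit Types (A K : {set V}) (v w : V) (x : point V) (h : boolfun V).

(* The empty body A = set0 and the tautological case v \in A are allowed. *)
Definition clause_sat A v x : bool := x v || [exists a in A, ~~ x a].

(* The pair (A, v) stands for the clause A -> v.  The empty conjunction, i.e.
   the constant function 1, is pure Horn. *)
Definition pure_horn h : Prop :=
  exists F : {set {set V} * V},
    forall x, h x = [forall c in F, clause_sat c.1 c.2 x].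

Definition implicate h A v : bool := [forall x, h x ==> clause_sat A v x].

Definition key h K : bool := [forall w in ~: K, implicate h K w].

Definition minimal_keys h : {set {set V}} := [set K | minset (key h) K].

Definition sperner (B : {set {set V}}) : Prop :=
  {in B &, forall A1 A2 : {set V}, A1 \subset A2 -> A1 = A2}.

Definition unique_key_hypergraph (B : {set {set V}}) : Prop :=
  sperner B /\ exists! h : boolfun V, pure_horn h /\ minimal_keys h = B.

End Horn.

Section Graph.

Variable V : finType.

Record graph := Graph {
  edges : {set {set V}};
  card_edge : {in edges, forall e : {set V}, #|e| = 2}
}.

Implicit Types (G : graph) (M : {set {set V}}).

Definition bipartite G : Prop :=
  exists A B : {set V},
    [/\ A :|: B = [set: V], [disjoint A & B]
      & {in edges G, forall e : {set V},
           exists a b : V, [/\ a \in A, b \in B & e = [set a; b]]}].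

Definition isolated G (v : V) : Prop := {in edges G, forall e : {set V}, v \notin e}.

Definition perfect_matching G M : Prop :=
  [/\ M \subset edges G, trivIset M & cover M = [set: V]].

Definition unique_key_graph G : Prop := unique_key_hypergraph (edges G).

End Graph.

(* Main.v *)
(** Closed sets of a pure Horn function are the supports of its true points.
    The largest candidate for a function with minimal keys [B] is the
    conjunction of all clauses [e -> v] with [e \in B]; its closed sets are [V]
    and the sets containing no member of [B].

    If the edges partition [V], any other candidate [h] agrees with it: if a
    clause [C -> v] of [h] failed at an independent set [S], adding to [S] the
    rest of the edge through [v] would keep it independent, hence not a key,
    while its closure contains that whole edge, hence is [V].

    Conversely, if [X] is one side of the bipartition and [v \in X], adding the
    clause [X \ v -> v] to the largest candidate yields a different function,
    and the minimal keys change only if some vertex has [v] as its unique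
    neighbour.  So under uniqueness every vertex has a pendant neighbour, and
    doing this twice shows that every vertex has degree one. *)
Require Import Defs.
From mathcomp Require Import all_boot.

Set Implicit Arguments.
Unset Strict Implicit.
Unset Printing Implicit Defensive.

Section PureHorn.

Variable V : finType.
Implicit Types (A K S e : {set V}) (v : V) (x : point V) (h : boolfun V).
Implicit Types (B : {set {set V}}) (F : {set {set V} * V}).

Definition indicator S : point V := [ffun v => v \in S].

Lemma indicator_support x : indicator [set v | x v] = x.
Proof. by apply/ffunP => v; rewrite ffunE inE. Qed.

Lemma clause_sat_indicator A v S :
  clause_sat A v (indicator S) = (A \subset S) ==> (v \in S).
Proof.
rewrite /clause_sat ffunE implybE orbC; congr (_ || _).
apply/existsP/subsetPn => [[a /andP[aA]]|[a aA aS]].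
  by rewrite ffunE => aS; exists a.
by exists a; rewrite aA ffunE.
Qed.

Definition horn_of F : boolfun V :=
  [ffun x => [forall c in F, clause_sat c.1 c.2 x]].

Lemma pure_horn_of F : pure_horn (horn_of F).
Proof. by exists F => x; rewrite ffunE. Qed.

Lemma pure_hornE h : pure_horn h -> exists F, h = horn_of F.
Proof. by case=> F hF; exists F; apply/ffunP => x; rewrite hF ffunE. Qed.

Lemma horn_ofP F S :
  reflect (forall A v, (A, v) \in F -> A \subset S -> v \in S)
          (horn_of F (indicator S)).
Proof.
rewrite ffunE; apply: (iffP forall_inP) => [H A v /H|H [A v] /H /=].
  by rewrite clause_sat_indicator => /implyP.
by move=> AS; rewrite clause_sat_indicator; apply/implyP.
Qed.

Lemma keyP h K :
  reflect (forall S, h (indicator S) -> K \subset S -> S = setT) (key h K).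
Proof.
apply: (iffP forall_inP) => [H S hS KS|H v vK].
  apply/setP => v; rewrite inE.
  have [/(subsetP KS)//|vK] := boolP (v \in K).
  have /forallP/(_ (indicator S)) : implicate h K v by apply: H; rewrite inE.
  by rewrite hS clause_sat_indicator KS.
apply/forallP => x; rewrite -(indicator_support x); apply/implyP => hx.
rewrite clause_sat_indicator; apply/implyP => Kx.
by rewrite (H _ hx Kx) inE.
Qed.

Lemma keyS h K1 K2 : K1 \subset K2 -> key h K1 -> key h K2.
Proof.
move=> K12 /keyP H; apply/keyP => S hS K2S.
exact: H hS (subset_trans K12 K2S).
Qed.

(** Keys are closed under supersets, so the minimal ones determine them all; the Sperner condition
    makes every member of [B] minimal among the sets containing a member of [B]. *)
Lemma minimal_keysP h B : sperner B ->
  minimal_keys h = B <-> (forall K, key h K = [exists e in B, e \subset K]).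
Proof.
move=> spB; split=> [<- K|H].
  apply/idP/existsP => [/minset_exists[K' minK' K'K]|[K' /andP[]]].
    by exists K'; rewrite inE minK'.
  by rewrite inE => /minsetp kK' K'K; apply: keyS kK'.
apply/setP => K; rewrite inE; apply/minsetP/idP => [[]|KB].
  rewrite H => /exists_inP[e eB eK] minK.
  suff <- : e = K by [].
  by apply: minK eK; rewrite H; apply/exists_inP; exists e.
split; first by rewrite H; apply/exists_inP; exists K.
move=> K'; rewrite H => /exists_inP[e eB eK'] K'K.
have eK : e = K by apply: spB => //; apply: subset_trans K'K.
by apply/eqP; rewrite eqEsubset K'K -{1}eK.
Qed.

Definition key_clauses B : {set {set V} * V} := setX B setT.

Lemma horn_of_key_clausesP B S :
  reflect (forall e, e \in B -> e \subset S -> S = setT)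
          (horn_of (key_clauses B) (indicator S)).
Proof.
apply: (iffP (horn_ofP _ _)) => [H e eB eS|H e v].
  by apply/setP => v; rewrite inE; apply: H eS; rewrite !inE eB.
by rewrite !inE andbT => eB eS; rewrite (H e eB eS) inE.
Qed.

(** A set [K] containing no member of [B] is itself closed, so it could be a key only if [K = setT];
    but [setT] contains [e0]. *)
Lemma minimal_keys_key_clauses B :
  sperner B -> B != set0 -> minimal_keys (horn_of (key_clauses B)) = B.
Proof.
move=> spB /set0Pn[e0 e0B]; apply/minimal_keysP => // K.
apply/keyP/exists_inP => [H|[e eB eK] S /horn_of_key_clausesP HS KS]; last first.
  exact: HS eB (subset_trans eK KS).
apply/exists_inP; apply: contraT => /exists_inPn indK.
have KT : K = setT.
  by apply: H => //; apply/horn_of_key_clausesP => e /indK/negbTE->.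
by move: (indK e0 e0B); rewrite KT subsetT.
Qed.

Lemma partition_unique_key_hypergraph B :
    sperner B -> B != set0 -> trivIset B -> cover B = setT ->
  unique_key_hypergraph B.
Proof.
move=> spB B0 tB cB; split=> //; exists (horn_of (key_clauses B)).
split; first by split; [apply: pure_horn_of | apply: minimal_keys_key_clauses].
move=> h [/pure_hornE[F ->{h}]]; set h := horn_of F.
move=> /(minimal_keysP _ spB) keyh.
have edge_key e : e \in B -> forall S, h (indicator S) -> e \subset S -> S = setT.
  by move=> eB; apply/keyP; rewrite keyh; apply/exists_inP; exists e.
apply/ffunP => x; rewrite -(indicator_support x); move: [set v | x v] => S.
apply/horn_of_key_clausesP/idP => [indS|hS e eB]; last exact: edge_key.
apply/horn_ofP => C v CvF CS; apply: contraT => vS.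
have : v \in cover B by rewrite cB.
case/bigcupP => e eB ve.
pose T := S :|: (e :\ v).
have : ~~ key h T.
  rewrite keyh; apply/exists_inPn => e' e'B; apply/negP => e'T.
  have [e'e|e'e] := eqVneq e' e.
    have := subsetP e'T v; rewrite e'e !inE eqxx /= orbF => /(_ ve).
    by apply/negP.
  have dis := trivIsetP tB _ _ e'B eB e'e.
  (* Being disjoint from [e], the edge [e'] must already lie in [S], which would force
     [S = setT]. *)
  suff e'S : e' \subset S by move: vS; rewrite (indS e' e'B e'S) inE.
  apply/subsetP => a ae'; have := subsetP e'T a ae'.
  by rewrite !inE (disjointFr dis ae') andbF orbF.
case/negP; apply/keyP => Z hZ.
rewrite subUset => /andP[SZ evZ].
have vZ : v \in Z by apply: (horn_ofP _ _ hZ) CvF (subset_trans CS SZ).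
by apply: (edge_key e) => //; rewrite -(setD1K ve) subUset sub1set vZ.
Qed.

End PureHorn.

Section BipartiteGraph.

Variables (V : finType) (G : graph V).
Implicit Types (X : {set V}) (u v : V).

(** A bipartition is recorded by one side only, so that swapping the sides is complementation. *)
Definition crossing X : Prop :=
  {in edges G, forall e : {set V},
     exists a b : V, [/\ a \in X, b \notin X & e = [set a; b]]}.

Lemma crossingC X : crossing X -> crossing (~: X).
Proof.
move=> cX e /cX[a [b [aX bX ->]]]; exists b, a.
by rewrite !inE aX bX setUC.
Qed.

Lemma bipartite_crossing : bipartite G -> exists X, crossing X.
Proof.
case=> A [B [_ disAB H]]; exists A => e /H[a [b [aA bB ->]]].
by exists a, b; split=> //; rewrite (disjointFl disAB bB).
Qed.

Lemma sperner_edges : sperner (edges G).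
Proof.
move=> e1 e2 e1E e2E e12; apply/eqP.
by rewrite eqEcard e12 (card_edge e1E) (card_edge e2E).
Qed.

Lemma nonisolatedP v :
  ~ isolated G v -> exists2 e, e \in edges G & v \in e.
Proof.
move=> niv; apply/exists_inP; apply/contra_notT: niv => /exists_inPn H e.
exact: H.
Qed.

Hypothesis G_noisolated : forall v, ~ isolated G v.
Hypothesis G_unique : unique_key_graph G.

Lemma pendant_neighbour X v : crossing X -> v \in X ->
  exists2 u, u \notin X &
    {in edges G, forall e : {set V}, u \in e -> e = [set u; v]}.
Proof.
move=> cX vX.
suff /exists_inP[u uX /forall_inP uE] :
    [exists u in ~: X, forall e in edges G, (u \in e) ==> (e == [set u; v])].
  exists u; first by rewrite inE in uX.
  by move=> e eE ue; apply/eqP; apply: (implyP (uE e eE)).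
apply: contraT => /exists_inPn noPendant.
have [e0 e0E _] := nonisolatedP (G_noisolated (v := v)).
have E0 : edges G != set0 by apply/set0Pn; exists e0.
have indX (e : {set V}) : e \in edges G -> ~~ (e \subset X).
  by move=> /cX[a [b [_ bX ->]]]; apply/subsetPn; exists b; rewrite // !inE eqxx orbT.
pose F1 := key_clauses (edges G); pose F2 := (X :\ v, v) |: F1.
have sat2 (S : {set V}) : horn_of F1 (indicator S) ->
    (X :\ v \subset S -> v \in S) -> horn_of F2 (indicator S).
  move=> /horn_ofP S1 SX; apply/horn_ofP => A w.
  by rewrite in_setU1 => /orP[/eqP[-> ->]//|]; apply: S1.
have sat21 (S : {set V}) : horn_of F2 (indicator S) -> horn_of F1 (indicator S).
  move=> /horn_ofP S2; apply/horn_ofP => A w AF; apply: S2.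
  by rewrite in_setU1 AF orbT.
have indep1 (S : {set V}) :
    (forall e : {set V}, e \in edges G -> ~~ (e \subset S)) ->
    horn_of F1 (indicator S).
  by move=> indS; apply/horn_of_key_clausesP => e /indS/negbTE->.
have keys1 := minimal_keys_key_clauses sperner_edges E0.
have keys2 : minimal_keys (horn_of F2) = edges G.
  apply/(minimal_keysP _ sperner_edges) => K.
  apply/keyP/exists_inP => [keyK|[e eE eK] S /sat21 /horn_of_key_clausesP S1 KS].
    apply/exists_inP; apply: contraT => /exists_inPn indK.
    have K2 : ~~ horn_of F2 (indicator K).
      apply/negP => /keyK/(_ (subxx K)) KT.
      by move: (indK e0 e0E); rewrite KT subsetT.
    (* [K] is independent, so the only clause of [F2] it can violate is the added one. *)
    have XK : X :\ v \subset K.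
      by apply: contraNT K2 => nXK; apply: sat2; [apply: indep1|rewrite (negbTE nXK)].
    (* A vertex [b] of [K] outside [X] has an edge avoiding [v], as it is not pendant at [v]. The
       other end of that edge lies in [X :\ v], hence in [K], so [K] would contain an edge. *)
    have KX : K \subset X.
      apply/subsetP => b bK; apply: contraT => bX.
      have := noPendant b; rewrite inE bX => /(_ isT) /forall_inPn[e eE].
      rewrite negb_imply => /andP[be enbv].
      case/negP: (indK e eE).
      have [a [c [aX cX' eac]]] := cX e eE.
      have bc : b = c.
        by move: be; rewrite eac !inE => /orP[/eqP ba|/eqP//]; rewrite ba aX in bX.
      move: enbv; rewrite eac -bc setUC => anv.
      rewrite subUset !sub1set bK (subsetP XK) // !inE aX andbT.
      by apply: contraNneq anv => ->.
    (* [X] is independent and contains [v], so it is closed for [F2] and lies above the key [K]. *)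
    have XT : X = setT by apply: keyK KX; apply: sat2 => //; apply: indep1.
    by move: (indX e0 e0E); rewrite XT subsetT.
  exact: S1 eE (subset_trans eK KS).
case: G_unique => _ [h [_ hE]].
have F12 : horn_of F1 = horn_of F2.
  have <- : h = horn_of F1 by apply: hE; split; [apply: pure_horn_of|].
  by apply: hE; split; [apply: pure_horn_of|].
(* The set [X :\ v] separates the two functions: it is independent but violates the added clause. *)
have : horn_of F2 (indicator (X :\ v)).
  rewrite -F12; apply: indep1 => e /indX; apply: contra => /subset_trans; apply.
  exact: subsetDl.
move=> /horn_ofP/(_ (X :\ v) v).
by rewrite in_setU1 eqxx subxx !inE eqxx => /(_ isT isT).
Qed.

(** Let [u] be pendant at [v], and [w] pendant at [u]. The edge at [w] contains [u], so it is the
    edge from [u] to [v]; hence [w = v], and [v] itself is pendant. *)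
Lemma unique_incident_edge X v : crossing X -> v \in X ->
  exists u, {in edges G, forall e : {set V}, v \in e -> e = [set v; u]}.
Proof.
move=> cX vX; have [u uX uE] := pendant_neighbour cX vX.
have [|w wX wE] := pendant_neighbour (crossingC cX) (v := u); first by rewrite inE.
have [e eE we] := nonisolatedP (G_noisolated (v := w)).
have ewu := wE e eE we.
have euv : e = [set u; v] by apply: uE => //; rewrite ewu !inE eqxx orbT.
have wv : w = v.
  move: we; rewrite euv !inE => /orP[/eqP wu|/eqP//].
  by move: wX; rewrite inE wu uX.
by exists u; rewrite -wv.
Qed.

End BipartiteGraph.

Theorem theorem4 (V : finType) (V_nonempty : 0 < #|V|) (G : graph V)
    (G_bipartite : bipartite G) (G_noisolated : forall v : V, ~ isolated G v) :
  unique_key_graph G <-> perfect_matching G (edges G).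
Proof.
split=> [G_unique|[_ tE cE]]; last first.
  apply: partition_unique_key_hypergraph tE cE; first exact: sperner_edges.
  case/card_gt0P: V_nonempty => v _.
  have [e eE _] := nonisolatedP (G_noisolated v).
  by apply/set0Pn; exists e.
have [X cX] := bipartite_crossing G_bipartite.
have unique_edge v :
    exists u, {in edges G, forall e : {set V}, v \in e -> e = [set v; u]}.
  have [vX|vX] := boolP (v \in X).
    exact: (unique_incident_edge G_noisolated G_unique cX vX).
  apply: (unique_incident_edge G_noisolated G_unique (crossingC cX)).
  by rewrite inE.
split=> //.
  apply/trivIsetP => e1 e2 e1E e2E; apply: contraNT => /pred0Pn[v /andP[ve1 ve2]].
  by have [u uE] := unique_edge v; rewrite (uE e1) // (uE e2).
apply/setP => v; rewrite inE; apply/bigcupP.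
by have [e eE ve] := nonisolatedP (G_noisolated v); exists e.
Qed.
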